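(* Let $f(z)=\sum_{k=0}^{\infty}p_kz^k$ be a power series with real coefficients $p_k\ge 0$ and with radius of convergence $R\in(0,\infty]$. Assume that $p_0=f(0)>0$ and that $f$ is not constant, and let $N=\sup\{k : p_k>0\}\in\{1,2,\ldots\}\cup\{\infty\}$. For $0<a<R$ let $P_a$ be the probability on $\mathbb{N}=\{0,1,2,\ldots\}$ defined by $P_a(\{k\})=p_ka^k/f(a)$, and let $F_f=\{P_a : 0<a<R\}$. Suppose that there exist a positive measure $\mu$ on $(0,R)$ and a sequence of numbers $(c_k)_{0\le k<N}$ such that for all integers $k$ with $0\le k<N$ and all $a\in(0,R)$, if $X\sim P_a$, then $$\Pr(X\le k)=c_k\int_{(a,R)}u^k\,\mu(du).$$ Then the exponential family $F_f$ is either a binomial family, or the Poisson family, or a negative binomial family.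
   Context: The three families are the following sets of probabilities on $\mathbb{N}=\{0,1,2,\ldots\}$. Binomial family: $\{B(n,p) : 0<p<1\}$ for some fixed integer $n\ge 1$, where $X\sim B(n,p)$ means $\mathbb{E}(z^X)=(1-p+pz)^n$. Poisson family: $\{\mathcal{P}_{\lambda} : \lambda>0\}$, where $X\sim\mathcal{P}_{\lambda}$ means $\mathbb{E}(z^X)=e^{\lambda(z-1)}$. Negative binomial family: $\{NB(\lambda,q) : 0<q<1\}$ for some fixed real $\lambda>0$, where $X\sim NB(\lambda,q)$ means $\mathbb{E}(z^X)=(1-q)^{\lambda}/(1-qz)^{\lambda}$. *)

(* Defs.v *)
From HB Require Import structures.
From mathcomp Require Import all_boot all_order all_algebra.
From mathcomp Require Import all_classical all_reals all_analysis.
Set Implicit Arguments.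
Unset Strict Implicit.
Unset Printing Implicit Defensive.
Import Order.TTheory GRing.Theory Num.Theory.
Import numFieldNormedType.Exports.
Local Open Scope classical_set_scope.
Local Open Scope ring_scope.

(* The set contains 0, so the supremum is nonnegative. *)
Definition convergence_radius (R : realType) (p : R^nat) : \bar R :=
  ereal_sup [set `|x|%:E | x in [set x : R | cvgn (pseries p x)]].

Definition power_sum (R : realType) (p : R^nat) (x : R) : R :=
  limn (pseries p x).

(* The interval from a to the (possibly infinite) radius of convergence, both
   ends excluded. *)
Definition radius_interval (R : realType) (p : R^nat) (a : R) : set R :=
  [set u | a < u /\ (u%:E < convergence_radius p)%E].

Definition support_sup (R : realType) (p : R^nat) : \bar R :=
  ereal_sup [set k%:R%:E | k in [set k : nat | 0 < p k]].

(* Such a P exists for a in (0, radius) when p is nonnegative and p 0 > 0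
   (power_law_exists), and its values on singletons determine it, since nat
   carries the discrete sigma-algebra. *)
Definition is_power_law (R : realType) (p : R^nat) (a : R)
    (P : probability nat R) : Prop :=
  forall k : nat, P [set k] = (p k * a ^+ k / power_sum p a)%:E.

Lemma cvg_pseries_in (R : realType) (p : R^nat) (a : R) :
  radius_interval p 0 a -> cvgn (pseries p a).
Proof.
case=> a0 /ereal_sup_gt[_ [x cx <-]]; rewrite lte_fin => ax.
by apply: is_cvg_pseries_inside cx _; rewrite gtr0_norm.
Qed.

Lemma power_law_exists (R : realType) (p : R^nat) (a : R) :
  (forall k, 0 <= p k) -> 0 < p 0%N -> radius_interval p 0 a ->
  exists P : probability nat R, is_power_law p a P.
Proof.
move=> p0 p00 aI; have ca := cvg_pseries_in aI; case: (aI) => a0 _.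
have w0 k : 0 <= p k * a ^+ k by rewrite mulr_ge0// exprn_ge0// ltW.
have [m [m1 mT]] : exists m : {measure set nat -> \bar R},
    (forall k, m [set k] = (p k * a ^+ k)%:E) /\ m setT = (power_sum p a)%:E.
  pose w k := NngNum (w0 k).
  exists (mseries (fun k => mscale (w k) (\d_k : {measure set nat -> \bar R})) 0).
  split=> [k|] /=; rewrite /mseries.
    rewrite (@nneseriesD1 _ _ k)//=.
    rewrite /mscale/= diracE mem_set// mule1 eseries0 ?adde0// => i _ ik.
    by rewrite /= /mscale/= diracE memNset ?mule0//= => /eqP; rewrite (negbTE ik).
  rewrite /power_sum -EFin_lim//; apply/congr_lim/funext => n /=.
  rewrite /pseries /series/= -sumEFin; apply: eq_bigr => i _.
  by rewrite /mscale/= diracT mule1.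
have f0 : 0 < power_sum p a.
  apply: lt_le_trans p00 _; rewrite -lee_fin -mT.
  have -> : (p 0%N)%:E = m [set 0%N] by rewrite m1 expr0 mulr1.
  by apply: le_measure; rewrite ?inE.
exists (mnormalize m \d_0%N) => k.
by rewrite /= /mnormalize mT eqe gt_eqF//= m1.
Qed.

Definition power_family (R : realType) (p : R^nat) : set (probability nat R) :=
  [set P | exists2 a, radius_interval p 0 a & is_power_law p a P].

(* The generating function is taken on the real interval [-1, 1], where it is
   always finite and determines P. *)
Definition has_pgf (R : realType) (P : probability nat R) (g : R -> R) : Prop :=
  forall z : R, `|z| <= 1 -> ('E_P[(fun k : nat => (z ^+ k)%R)] = (g z)%:E)%E.

Definition binomial_family (R : realType) (n : nat) : set (probability nat R) :=
  [set P | exists2 q : R, 0 < q < 1 &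
    has_pgf P (fun z => (1 - q + q * z) ^+ n)].

Definition poisson_family (R : realType) : set (probability nat R) :=
  [set P | exists2 l : R, 0 < l & has_pgf P (fun z => expR (l * (z - 1)))].

Definition negative_binomial_family (R : realType) (l : R) :
    set (probability nat R) :=
  [set P | exists2 q : R, 0 < q < 1 &
    has_pgf P (fun z => (1 - q) `^ l / (1 - q * z) `^ l)].

Arguments binomial_family R n : clear implicits.
Arguments poisson_family R : clear implicits.
Arguments negative_binomial_family R l : clear implicits.

(* Main.v *)
(* Only the hypotheses for k = 0 and k = 1 matter. Their left-hand sides are
   p0 / f and (p0 + p1 a) / f, and their right-hand sides have differentials
   - c0 dmu and - c1 u dmu, so that d((p0 + p1 a) / f) = kappa a d(p0 / f) with
   kappa = c1 / c0, that is, (p0 + B a) f' = p1 f with B = p1 - kappa p0. To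
   avoid differentiating integrals, the identity is obtained as the limit of
   two-sided bounds on increments. On coefficients it reads
   p0 (k + 1) p_(k+1) = (p1 - B k) p_k, and the sign of B separates the three
   families: B = 0 gives the Poisson one, B < 0 the negative binomial one, and
   for B > 0 nonnegativity forces p1 / B to be an integer, which gives the
   binomial one. When N = 1 only k = 0 is available, but then f is affine. *)

Require Import Defs.
From HB Require Import structures.
From mathcomp Require Import all_boot all_order all_algebra.
From mathcomp Require Import all_classical all_reals all_analysis.
From mathcomp Require Import measurable_realfun ring lra.
Set Implicit Arguments.
Unset Strict Implicit.
Unset Printing Implicit Defensive.
Import Order.TTheory GRing.Theory Num.Theory.
Import numFieldNormedType.Exports.
Local Open Scope classical_set_scope.
Local Open Scope ring_scope.

(** * Power series *)

Section PowerSeries.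
Variable R : realType.
Implicit Types (c d : R^nat) (x y z r l K M : R).

(** Abel's lemma: the terms at [x] are dominated by a geometric series of ratio [|x| / |y|]. Asking
    only for bounded terms at [y] lets it apply where convergence at [y] is not known. *)
Lemma is_cvg_pseries_bounded c M y x :
  (forall k, `|c k * y ^+ k| <= M) -> `|x| < `|y| -> cvgn (pseries c x).
Proof.
move=> cM xy; have y0 : 0 < `|y| := le_lt_trans (normr_ge0 _) xy.
have M0 : 0 <= M by apply: le_trans (cM 0%N).
apply: normed_cvg => /=.
apply: (@series_le_cvg _ _ (geometric M (`|x| / `|y|))) => [n|n|n|] /=.
- exact: normr_ge0.
- by rewrite mulr_ge0// exprn_ge0// divr_ge0.
- rewrite expr_div_n mulrA ler_pdivlMr ?exprn_gt0// normrM normrX mulrAC.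
  by rewrite ler_wpM2r ?exprn_ge0// -normrX -normrM.
- apply: is_cvg_geometric_series.
  by rewrite normrM normfV !normr_id ltr_pdivrMr ?mul1r.
Qed.

Lemma cvg_pseries_bounded c y :
  cvgn (pseries c y) -> exists M, forall k, `|c k * y ^+ k| <= M.
Proof.
move=> /cvg_series_bounded[M [Mr Mc]]; exists (`|M| + 1) => k.
by apply: Mc => //; rewrite (le_lt_trans (ler_norm M))// ltrDl.
Qed.

(** Each of the [k + 1] terms of [1 + r + ... + r ^+ k] is at least [r ^+ k], and this sum times
    [1 - r] telescopes. The bound absorbs the factor [k + 1] that differentiation creates. *)
Lemma geometric_linear_bound r k :
  0 <= r < 1 -> k.+1%:R * r ^+ k * (1 - r) <= 1 - r ^+ k.+1.
Proof.
case/andP => r0 r1; elim: k => [|k ih]; first by rewrite expr0 expr1; lra.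
have u0 := exprn_ge0 k.+1 r0; have u1 := exprn_ile1 k.+1 r0 (ltW r1).
rewrite [r ^+ k.+2]exprS -natr1; set u := r ^+ k.+1 in ih u0 u1 *.
have -> : (k.+1%:R + 1) * u * (1 - r) =
    r * (k.+1%:R * r ^+ k * (1 - r)) + u * (1 - r).
  by rewrite /u exprS; ring.
have := ler_wpM2l r0 ih; nra.
Qed.

Lemma is_cvg_pseries_diffs c y x :
  cvgn (pseries c y) -> `|x| < `|y| -> cvgn (pseries (pseries_diffs c) x).
Proof.
move=> /cvg_pseries_bounded[M cM] xy.
have y0 : 0 < `|y| := le_lt_trans (normr_ge0 _) xy.
have M0 : 0 <= M by apply: le_trans (cM 0%N).
(* An intermediate point: the gap from [z] to [|y|] pays for the factor [k + 1], the gap from [|x|]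
   to [z] gives convergence. *)
pose z := (`|x| + `|y|) / 2.
have xz : `|x| < z by rewrite /z; lra.
have zy : z < `|y| by rewrite /z; lra.
have z0 : 0 < z := le_lt_trans (normr_ge0 _) xz.
pose r := z / `|y|.
have r01 : 0 <= r < 1 by rewrite divr_ge0 ?ltW//= ltr_pdivrMr ?mul1r.
apply: (@is_cvg_pseries_bounded _ (M / `|y| / (1 - r)) z); last first.
  by rewrite (gtr0_norm z0).
move=> k; rewrite ler_pdivlMr; last by lra.
rewrite ler_pdivlMr// /pseries_diffs !normrM normr_nat normrX (gtr0_norm z0).
have -> : z ^+ k = r ^+ k * `|y| ^+ k by rewrite -exprMn /r divfK ?gt_eqF.
have := cM k.+1; rewrite normrM normrX exprS => cMk.
have -> : k.+1%:R * `|c k.+1| * (r ^+ k * `|y| ^+ k) * (1 - r) * `|y| =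
  (k.+1%:R * r ^+ k * (1 - r)) * (`|c k.+1| * (`|y| * `|y| ^+ k)) by ring.
rewrite -[leRHS]mul1r ler_pM//.
  by rewrite !mulr_ge0// ?exprn_ge0//; lra.
rewrite (le_trans (geometric_linear_bound k r01))//.
by rewrite lerBlDr lerDl exprn_ge0//; case/andP: r01.
Qed.

Lemma convergence_radius_gt c x :
  (`|x|%:E < convergence_radius c)%E ->
  exists2 y, `|x| < `|y| & cvgn (pseries c y).
Proof.
by move=> /ereal_sup_gt[_ [y cy <-]]; rewrite lte_fin => xy; exists y.
Qed.

Lemma is_cvg_pseries_radius c x :
  (`|x|%:E < convergence_radius c)%E -> cvgn (pseries c x).
Proof.
by move=> /convergence_radius_gt[y xy cy]; apply: is_cvg_pseries_inside cy xy.
Qed.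

Lemma is_cvg_pseries_diffs_radius c x :
  (`|x|%:E < convergence_radius c)%E -> cvgn (pseries (pseries_diffs c) x).
Proof.
by move=> /convergence_radius_gt[y xy cy]; apply: is_cvg_pseries_diffs cy xy.
Qed.

Lemma is_derive_pseries c K x : cvgn (pseries c K) -> `|x| < `|K| ->
  is_derive x 1 (power_sum c) (power_sum (pseries_diffs c) x).
Proof.
(* Termwise differentiation needs the series and its first two derived series to converge at a point
   beyond [|x|]. Each derivation costs a step inwards, from [|K|] to [z] and then to [y]. *)
move=> cK xK; pose y := (2 * `|x| + `|K|) / 3; pose z := (`|x| + 2 * `|K|) / 3.
have x0 := normr_ge0 x.
have y0 : 0 <= y by rewrite /y; lra.
have z0 : 0 <= z by rewrite /z; lra.
have cz : cvgn (pseries (pseries_diffs c) z).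
  by apply: is_cvg_pseries_diffs cK _; rewrite (ger0_norm z0) /z; lra.
apply: (@pseries_snd_diffs _ _ y).
- by apply: is_cvg_pseries_inside cK _; rewrite (ger0_norm y0) /y; lra.
- by apply: is_cvg_pseries_inside cz _; rewrite !ger0_norm// /z /y; lra.
- by apply: is_cvg_pseries_diffs cz _; rewrite !ger0_norm// /z /y; lra.
- by rewrite (ger0_norm y0) /y; lra.
Qed.

Lemma is_derive_power_sum c x : (`|x|%:E < convergence_radius c)%E ->
  is_derive x 1 (power_sum c) (power_sum (pseries_diffs c) x).
Proof.
by move=> /convergence_radius_gt[y xy cy]; apply: is_derive_pseries cy xy.
Qed.

Lemma power_sum0 c : power_sum c 0 = c 0%N.
Proof.
rewrite /power_sum; apply/cvg_lim => //; rewrite -cvg_shiftS.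
apply: cvg_near_cst; apply: nearW => n.
rewrite /pseries/= /series/= big_nat_recl//= expr0 mulr1 big1 ?addr0// => i _.
by rewrite expr0n mulr0.
Qed.

Lemma cvg_pseries_shift c x l :
  pseries (c \o succn) x @ \oo --> l -> pseries c x @ \oo --> c 0%N + x * l.
Proof.
move=> cl; rewrite -cvg_shiftS.
have -> : (fun n => pseries c x n.+1) =
    (fun n => c 0%N + x * pseries (c \o succn) x n).
  apply/funext => n; rewrite /pseries /series/= big_nat_recl//= expr0 mulr1.
  rewrite mulr_sumr; congr (_ + _).
  by apply: eq_bigr => i _; rewrite exprS; ring.
by apply: cvgD; [exact: cvg_cst|apply: cvgM => //; exact: cvg_cst].
Qed.

Lemma is_cvg_pseries_shift c x :
  x != 0 -> cvgn (pseries c x) -> cvgn (pseries (c \o succn) x).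
Proof.
move=> x0 /cvg_ex[l]; rewrite -cvg_shiftS => cl; apply: cvgP.
have -> : pseries (c \o succn) x = (fun n => x^-1 * (pseries c x n.+1 - c 0%N)).
  apply/funext => n; rewrite /pseries /series/= big_nat_recl//= expr0 mulr1.
  rewrite addrC addKr mulr_sumr; apply: eq_bigr => i _; rewrite exprS.
  by field.
by apply: cvgM; [exact: cvg_cst|apply: cvgB; [exact: cl|exact: cvg_cst]].
Qed.

(** By continuity the constant coefficient is the limit at [0] from the right, hence zero. Dividing
    by [x] shifts the coefficients, and the argument repeats. *)
Lemma power_sum_eq0 c K : 0 < K -> cvgn (pseries c K) ->
  (forall x, 0 < x < K -> power_sum c x = 0) -> forall n, c n = 0.
Proof.
move=> K0; have head d : cvgn (pseries d K) ->
    (forall x, 0 < x < K -> power_sum d x = 0) -> d 0%N = 0.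
  move=> dK dz; have K0' : `|0 : R| < `|K| by rewrite normr0 gtr0_norm.
  have [+ _] := is_derive_pseries dK K0'.
  move=> /derivable1_diffP/differentiable_continuous/cvg_at_right_filter.
  rewrite power_sum0 => ct; apply: (cvg_unique (@Rhausdorff R) ct).
  apply: cvg_near_cst; near=> x; apply: dz; apply/andP.
  by split; near: x; [exact: nbhs_right_gt|exact: nbhs_right_lt].
move=> cK cz n; elim: n c cK cz => [|n ih] c cK cz; first exact: head cK cz.
have cSK : cvgn (pseries (c \o succn) K).
  by apply: is_cvg_pseries_shift; rewrite ?gt_eqF.
apply: (ih (c \o succn)) => // x /andP[x0 xK].
have : cvgn (pseries (c \o succn) x).
  by apply: is_cvg_pseries_inside cSK _; rewrite !gtr0_norm.
move=> /cvg_pseries_shift/(cvg_lim (@Rhausdorff _)).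
rewrite -/(power_sum c x) -/(power_sum _ x) cz ?x0// (head c)// add0r.
by move/eqP; rewrite eq_sym mulf_eq0 gt_eqF//= => /eqP.
Unshelve. all: by end_near. Qed.

Lemma power_sum_inj c d K : 0 < K -> cvgn (pseries c K) -> cvgn (pseries d K) ->
  (forall x, 0 < x < K -> power_sum c x = power_sum d x) -> c = d.
Proof.
move=> K0 cK dK cd; apply/funext => n; apply/eqP; rewrite -subr_eq0; apply/eqP.
have pB x : pseries (fun n => c n - d n) x = pseries c x - pseries d x.
  apply/funext => m; rewrite /pseries /series/= /GRing.add/= /GRing.opp/=.
  rewrite -sumrB.
  by apply: eq_bigr => i _; rewrite mulrBl.
apply: (@power_sum_eq0 (fun n => c n - d n) K) => // [|x /andP[x0 xK]].
  by rewrite pB; apply: is_cvgB.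
have xK' : `|x| < `|K| by rewrite !gtr0_norm// (lt_trans x0).
rewrite /power_sum pB limB//; try exact: is_cvg_pseries_inside xK'.
by rewrite -!/(power_sum _ _) cd ?subrr// x0.
Qed.

End PowerSeries.

(** * Generating functions and power families *)

Lemma pgf_power_sum (R : realType) (P : probability nat R) (w : R^nat) (z : R) :
  (forall k, P [set k] = (w k)%:E) -> `|z| <= 1 ->
  cvgn (pseries w z) /\
  ('E_P[(fun k : nat => (z ^+ k)%R)] = (power_sum w z)%:E)%E.
Proof.
move=> Pw z1.
have w0 k : 0 <= w k by rewrite -lee_fin -Pw.
have zk k : `|z ^+ k| <= 1 by rewrite normrX exprn_ile1.
have tI : trivIset setT (fun k : nat => [set k]).
  by move=> i j _ _ [k [/= <- <-]].
have w1 n : series w n <= 1.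
  rewrite -lee_fin /series/= -sumEFin big_mkord.
  under eq_bigr do rewrite -Pw.
  by rewrite -measure_bigsetU// probability_le1.
have cw : cvgn (series w).
  apply: nondecreasing_is_cvgn; first exact: nondecreasing_series.
  by exists 1 => _ [n _ <-].
have cwz : cvgn (pseries w z).
  apply: normed_cvg; apply: series_le_cvg cw => // k /=; first exact: normr_ge0.
  by rewrite normrM (ger0_norm (w0 k)) ler_piMr.
split=> //; rewrite unlock.
have -> : [set: nat] = \bigcup_k [set k].
  by apply/seteqP; split => // k _; exists k.
(* The expectation is split over singletons; this is legitimate because [z ^+ k] is bounded by the
   integrable constant [1]. *)
rewrite integral_bigcup//; last first.
  apply: (@le_integrable _ _ _ _ _ _ _ (cst 1%E)) => //.
    by move=> k _; rewrite /= normr1 lee_fin.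
  exact: finite_measure_integrable_cst.
transitivity (\sum_(i <oo) (w i * z ^+ i)%:E)%E.
  apply: eq_eseriesr => i _.
  rewrite (eq_integral (cst (z ^+ i)%:E)); last first.
    by move=> x; rewrite inE => ->.
  by rewrite integral_cst// EFinM muleC -Pw.
rewrite /power_sum -EFin_lim//; apply/congr_lim/funext => n /=.
by rewrite /pseries /series/= -sumEFin.
Qed.

Lemma radius_interval_norm (R : realType) (p : R^nat) (a : R) :
  radius_interval p 0 a -> (`|a|%:E < convergence_radius p)%E.
Proof. by case=> a0 aR; rewrite gtr0_norm. Qed.

Lemma power_law_pgf (R : realType) (p : R^nat) (a z : R)
    (P : probability nat R) :
  radius_interval p 0 a -> is_power_law p a P -> `|z| <= 1 ->
  ('E_P[(fun k : nat => (z ^+ k)%R)] =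
   (power_sum p (a * z) / power_sum p a)%:E)%E.
Proof.
move=> aI Pa z1; rewrite (pgf_power_sum Pa z1).2; congr (_%:E).
have pE : pseries (fun k => p k * a ^+ k / power_sum p a) z =
    (fun n => pseries p (a * z) n / power_sum p a).
  apply/funext => n; rewrite /pseries /series/= mulr_suml.
  by apply: eq_bigr => i _; rewrite exprMn; ring.
rewrite {1}/power_sum pE; apply/cvg_lim => //; apply: cvgMr_tmp.
apply: is_cvg_pseries_radius; apply: le_lt_trans (radius_interval_norm aI).
by rewrite lee_fin normrM ler_piMr.
Qed.

(** Reduces an equality of families to a matching of parameters in both directions: the law [P_a]
    has generating function [f (a z) / f a], and a generating function determines its law. *)
Lemma power_family_eq (R : realType) (p : R^nat) (D : set R) (g : R -> R -> R) :
  (forall a, radius_interval p 0 a -> exists2 q, D q &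
    forall z, `|z| <= 1 -> power_sum p (a * z) / power_sum p a = g q z) ->
  (forall q, D q -> exists2 a, radius_interval p 0 a &
    forall z, `|z| <= 1 -> power_sum p (a * z) / power_sum p a = g q z) ->
  (forall k, 0 <= p k) -> 0 < p 0%N ->
  power_family p = [set P | exists2 q, D q & has_pgf P (g q)].
Proof.
move=> pg gp p0 p00; apply/seteqP; split => P.
  move=> [a aI aP]; have [q Dq qE] := pg a aI.
  by exists q => // z z1; rewrite (power_law_pgf aI aP)// qE.
move=> [q /gp[a aI qE] Pq]; exists a => //.
(* [P] and the power law [Q] share their generating function on [[-1, 1]], so their weights agree by
   uniqueness of power series coefficients. *)
have [Q aQ] := power_law_exists p0 p00 aI.
pose w k := fine (P [set k]).
have Pw k : P [set k] = (w k)%:E by rewrite fineK// fin_num_measure.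
move=> k; rewrite Pw.
suff -> : w = (fun k => p k * a ^+ k / power_sum p a) by [].
have n1 : `|1 : R| <= 1 by rewrite normr1.
apply: (@power_sum_inj _ _ _ 1) => //.
- exact: (pgf_power_sum Pw n1).1.
- exact: (pgf_power_sum aQ n1).1.
- move=> x /andP[x0 x1]; have xn1 : `|x| <= 1 by rewrite gtr0_norm ?ltW.
  apply: EFin_inj; rewrite -(pgf_power_sum Pw xn1).2 -(pgf_power_sum aQ xn1).2.
  by rewrite (power_law_pgf aI aQ)// Pq// qE.
Qed.

(** * Truncated moments *)

Lemma power_law_cdf (R : realType) (p : R^nat) (a : R)
    (P : probability nat R) (k : nat) :
  is_power_law p a P ->
  P [set j : nat | (j <= k)%N] =
    ((\sum_(i < k.+1) p i * a ^+ i) / power_sum p a)%:E.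
Proof.
move=> Pa; have -> : [set j : nat | (j <= k)%N] =
    \big[setU/set0]_(i < k.+1) [set nat_of_ord i].
  rewrite -(bigcup_mkord k.+1 (fun i : nat => [set i])).
  by apply/seteqP; split=> [j /= jk|j [i /= ik ->]]; [exists j|].
rewrite (@measure_bigsetU _ _ _ P (fun i : nat => [set i]))//.
  by rewrite mulr_suml -sumEFin; apply: eq_bigr => i _; exact: Pa.
by move=> i j _ _ [l [/= <- <-]].
Qed.

Lemma radius_interval_split (R : realType) (p : R^nat) (a b : R) :
  a < b -> (b%:E < convergence_radius p)%E ->
  radius_interval p a = `]a, b]%classic `|` radius_interval p b.
Proof.
move=> ab bR; apply/seteqP; split=> [u [au uR]|u].
  by have [ub|bu] := leP u b; [left; rewrite /= in_itv/= au|right].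
case=> [/=|[bu uR]]; last by split=> //; exact: lt_trans bu.
rewrite in_itv/= => /andP[au ub]; split => //.
by rewrite (le_lt_trans _ bR)// lee_fin.
Qed.

Lemma measurable_radius_interval (R : realType) (p : R^nat) (a : R) :
  measurable (radius_interval p a : set (measurableTypeR R)).
Proof.
rewrite /radius_interval; case: (convergence_radius p) => [r| |].
- have -> : [set u | a < u /\ (u%:E < r%:E)%E] = `]a, r[%classic;
    last exact: measurable_itv.
  by apply/seteqP; split=> u /=; rewrite in_itv/= lte_fin => /andP.
- have -> : [set u | a < u /\ (u%:E < +oo)%E] = `]a, +oo[%classic;
    last exact: measurable_itv.
  by apply/seteqP; split=> u /=; rewrite in_itv/= andbT ltry => // -[].
- have -> : [set u | a < u /\ (u%:E < -oo)%E] = set0;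
    last exact: measurable0.
  by apply/seteqP; split=> u //= [].
Qed.

(** Neither the sign of [c k] nor the finiteness of the integrals is assumed in the theorem; both
    follow from the product being finite and positive. With [c = 0] and [x = +oo] the product is [0]
    by convention, so that case is excluded too. *)
Lemma EFin_mul_eq_fin (R : realType) (c y : R) (x : \bar R) :
  (0 <= x)%E -> (c%:E * x = y%:E)%E -> 0 < y -> 0 < c /\ x = (y / c)%:E.
Proof.
case: x => [x| |]//.
- rewrite lee_fin => x0 [<-] y0.
  have c0 : 0 < c.
    by rewrite ltNge; apply/negP => c0; move: y0; rewrite ltNge mulr_le0_ge0.
  by split => //; rewrite mulrAC divff ?mul1r// gt_eqF.
- have [c0|c0|->] := ltrgtP c 0.
  + by rewrite lt0_muley.
  + by rewrite gt0_muley.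
  + by rewrite mul0e => _ [<-]; rewrite ltxx.
Qed.

Section TruncatedMoments.
Variables (R : realType) (p : R^nat).
Variable mu : {measure set (measurableTypeR R) -> \bar R}.

Let measurable_expr (D : set (measurableTypeR R)) (k : nat) :
  measurable_fun D (fun u => ((u : R) ^+ k)%:E : \bar R).
Proof. by apply/measurable_EFinP; apply: measurable_funX. Qed.

Lemma moment_increment (k : nat) (c : R) (F : R -> R) (a b : R) :
  (forall x, radius_interval p 0 x -> 0 < F x) ->
  (forall x, radius_interval p 0 x ->
    (c%:E * \int[mu]_(u in radius_interval p x) (u ^+ k)%:E = (F x)%:E)%E) ->
  0 < a -> a < b -> (b%:E < convergence_radius p)%E ->
  0 < c /\ (\int[mu]_(u in `]a, b]) (u ^+ k)%:E = ((F a - F b) / c)%:E)%E.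
Proof.
move=> F_gt0 F_int a0 ab bR.
have bI : radius_interval p 0 b by split => //; exact: lt_trans ab.
have aI : radius_interval p 0 a by split => //; rewrite (lt_trans _ bR).
have I0 x : radius_interval p 0 x ->
    (0 <= \int[mu]_(u in radius_interval p x) (u ^+ k)%:E)%E.
  move=> [x0 _]; apply: integral_ge0 => u [xu _].
  by rewrite lee_fin exprn_ge0// ltW// (lt_trans x0).
have [c0 Ia] := EFin_mul_eq_fin (I0 a aI) (F_int a aI) (F_gt0 a aI).
have [_ Ib] := EFin_mul_eq_fin (I0 b bI) (F_int b bI) (F_gt0 b bI).
(* The integral beyond [a] is the one over []a, b]] plus the one beyond [b]; the latter is finite
   and can be subtracted. *)
split=> //; move: Ia; rewrite (radius_interval_split ab bR) ge0_integral_setU//.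
- by rewrite Ib => IE; rewrite mulrBl EFinB -IE addeK.
- exact: measurable_radius_interval.
- rewrite -radius_interval_split// => u [au _].
  by rewrite lee_fin exprn_ge0// ltW// (lt_trans a0).
- rewrite disj_set2E; apply/eqP/seteqP; split => // u [/=].
  rewrite in_itv/= => /andP[_ ub] [bu _].
  by move: (lt_le_trans bu ub); rewrite ltxx.
Qed.

(* The difference form of dF1 = (c1 / c0) u dF0, as dFk = - ck u ^+ k dmu. *)
Lemma moment_slope (c0 c1 : R) (F0 F1 : R -> R) (a b : R) :
  (forall x, radius_interval p 0 x -> 0 < F0 x /\ 0 < F1 x) ->
  (forall x, radius_interval p 0 x ->
    (c0%:E * \int[mu]_(u in radius_interval p x) (u ^+ 0)%:E = (F0 x)%:E)%E) ->
  (forall x, radius_interval p 0 x ->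
    (c1%:E * \int[mu]_(u in radius_interval p x) (u ^+ 1)%:E = (F1 x)%:E)%E) ->
  0 < a -> a < b -> (b%:E < convergence_radius p)%E ->
  c1 / c0 * a * (F0 a - F0 b) <= F1 a - F1 b <= c1 / c0 * b * (F0 a - F0 b).
Proof.
move=> F_gt0 F0_int F1_int a0 ab bR.
have [c00 J0] := moment_increment (fun x xI => (F_gt0 x xI).1) F0_int a0 ab bR.
have [c10 J1] := moment_increment (fun x xI => (F_gt0 x xI).2) F1_int a0 ab bR.
have mI : measurable (`]a, b]%classic : set (measurableTypeR R)).
  exact: measurable_itv.
have Zl (r : R) : 0 <= r -> (\int[mu]_(u in `]a, b]) (r%:E * (u ^+ 0)%:E) =
    (r * ((F0 a - F0 b) / c0))%:E)%E.
  by move=> r0; rewrite ge0_integralZl ?J0.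
have pos (u r : R) : 0 <= r -> (0 <= r%:E * (u ^+ 0)%:E)%E.
  by move=> r0; rewrite expr0 mule1 lee_fin.
have b0 : 0 < b by exact: lt_trans ab.
have mr r : measurable_fun (`]a, b]%classic : set (measurableTypeR R))
    (fun u : R => r%:E * (u ^+ 0)%:E)%E by exact: measurable_funeM.
(* Since [a <= u <= b] on the interval, the first moment lies between [a] and [b] times the
   zeroth. *)
have leJ1 : (\int[mu]_(u in `]a, b]) (a%:E * (u ^+ 0)%:E) <=
    \int[mu]_(u in `]a, b]) (u ^+ 1)%:E)%E.
  apply: ge0_le_integral => // [u uI|u]; first exact: pos (ltW a0).
  by rewrite /= in_itv/= => /andP[/ltW au _]; rewrite expr0 mule1 expr1 lee_fin.
have geJ1 : (\int[mu]_(u in `]a, b]) (u ^+ 1)%:E <=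
    \int[mu]_(u in `]a, b]) (b%:E * (u ^+ 0)%:E))%E.
  apply: ge0_le_integral => // u; rewrite /= in_itv/= => /andP[au ub].
    by rewrite expr1 lee_fin ltW// (lt_trans a0).
  by rewrite expr0 mule1 expr1 lee_fin.
move: leJ1 geJ1; rewrite !Zl ?(ltW a0) ?(ltW b0)// J1 !lee_fin.
rewrite ler_pdivlMr// ler_pdivrMr//.
set x := F0 a - F0 b; set y := F1 a - F1 b => l r.
apply/andP; split; [move: l|move: r].
all: by congr (_ <= _); field; rewrite gt_eqF.
Qed.

End TruncatedMoments.

(** * The differential equation *)

Section PowerSeriesODE.
Variables (R : realType) (p : R^nat).

Lemma power_sum_gt0 x : (forall k, 0 <= p k) -> 0 < p 0%N -> 0 <= x ->
  cvgn (pseries p x) -> 0 < power_sum p x.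
Proof.
move=> p0 p00 x0 cx; apply: (lt_le_trans p00); apply: limr_ge => //.
near=> n; have n0 : (0 < n)%N by near: n; exists 1%N.
rewrite /pseries /series/= -(prednK n0) big_nat_recl//= expr0 mulr1 lerDl.
by rewrite sumr_ge0// => i _; rewrite mulr_ge0// exprn_ge0.
Unshelve. all: by end_near. Qed.

Lemma power_sum_cst x : (forall k, p k.+1 = 0) -> power_sum p x = p 0%N.
Proof.
move=> p0; apply/cvg_lim => //; rewrite -cvg_shiftS.
apply: cvg_near_cst; apply: nearW => n.
rewrite /pseries/= /series/= big_nat_recl//= expr0 mulr1 big1 ?addr0// => i _.
by rewrite p0 mul0r.
Qed.

Lemma in_convergence_radius (x y : R) :
  cvgn (pseries p y) -> `|x| < `|y| -> (`|x|%:E < convergence_radius p)%E.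
Proof.
move=> cy xy; apply: (@lt_le_trans _ _ (`|y|%:E)); first by rewrite lte_fin.
by apply: ereal_sup_ubound; exists y.
Qed.

Lemma cvg_pseries_ode (A B C x : R) : (`|x|%:E < convergence_radius p)%E ->
  pseries (fun k => A * pseries_diffs p k + (B * k%:R - C) * p k) x @ \oo -->
  (A + B * x) * power_sum (pseries_diffs p) x - C * power_sum p x.
Proof.
move=> xR; have cp := is_cvg_pseries_radius xR.
have cd := is_cvg_pseries_diffs_radius xR.
(* The coefficients [k * p k] are those of [x f']: their shift is [pseries_diffs p] and their
   constant term is zero. *)
have := @cvg_pseries_shift _ (fun k => k%:R * p k) _ _ cd.
rewrite mul0r add0r => cs.
have -> : pseries (fun k => A * pseries_diffs p k + (B * k%:R - C) * p k) x =
    (fun n => A * pseries (pseries_diffs p) x n +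
              B * pseries (fun k => k%:R * p k) x n - C * pseries p x n).
  apply/funext => n; rewrite /pseries /series/= !mulr_sumr -big_split/= -sumrB.
  by apply: eq_bigr => i _; ring.
rewrite mulrDl -mulrA; apply: cvgB; last exact: cvgMr.
by apply: cvgD; exact: cvgMr.
Qed.

(** The difference of the two sides of the equation is itself a power series, vanishing on an
    interval to the right of [0], so each of its coefficients is zero. *)
Lemma ode_coef (A B C : R) : (0 < convergence_radius p)%E ->
  (forall x, radius_interval p 0 x ->
    (A + B * x) * power_sum (pseries_diffs p) x = C * power_sum p x) ->
  forall k, A * (k.+1%:R * p k.+1) = (C - B * k%:R) * p k.
Proof.
move=> Rp ode k.
have [y] : exists2 y, `|0 : R| < `|y| & cvgn (pseries p y).
  by apply: convergence_radius_gt; rewrite normr0.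
rewrite normr0 => y0 cy; have K0 : 0 < `|y| / 2 by rewrite divr_gt0.
have inR x : 0 < x -> x <= `|y| / 2 -> (`|x|%:E < convergence_radius p)%E.
  by move=> x0 xy; apply: in_convergence_radius cy _; rewrite gtr0_norm//; lra.
pose w k := A * pseries_diffs p k + (B * k%:R - C) * p k.
suff : w k = 0.
  rewrite /w /pseries_diffs => wk; apply/eqP; rewrite -subr_eq0 -wk; apply/eqP.
  by ring.
apply: (@power_sum_eq0 _ w (`|y| / 2)) => // [|x /andP[x0 xy]].
  by apply: cvgP; apply: cvg_pseries_ode; exact: inR.
have xR := inR x x0 (ltW xy); apply/cvg_lim => //.
rewrite -(subrr (C * power_sum p x)) -{1}ode; first exact: cvg_pseries_ode.
by split => //; rewrite -(gtr0_norm x0).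
Qed.

Lemma coef_ode (A B C x : R) : (`|x|%:E < convergence_radius p)%E ->
  (forall k, A * (k.+1%:R * p k.+1) = (C - B * k%:R) * p k) ->
  (A + B * x) * power_sum (pseries_diffs p) x = C * power_sum p x.
Proof.
move=> xR rec; apply/eqP; rewrite -subr_eq0; apply/eqP.
rewrite -(cvg_lim _ (@cvg_pseries_ode A B C x xR))//; apply/cvg_lim => //.
apply: cvg_near_cst; apply: nearW => n.
rewrite /pseries /series/= big1// => i _.
by rewrite /pseries_diffs rec; ring.
Qed.

Lemma slope_ode (k a : R) : (forall k, 0 <= p k) -> 0 < p 0%N ->
  (forall a b, 0 < a -> a < b -> (b%:E < convergence_radius p)%E ->
    let F0 x := p 0%N / power_sum p x in
    let F1 x := (p 0%N + p 1%N * x) / power_sum p x in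
    k * a * (F0 a - F0 b) <= F1 a - F1 b <= k * b * (F0 a - F0 b)) ->
  radius_interval p 0 a ->
  (p 0%N + (p 1%N - k * p 0%N) * a) * power_sum (pseries_diffs p) a =
  p 1%N * power_sum p a.
Proof.
move=> p_ge0 p0_gt0 slope aI; have aR := radius_interval_norm aI.
have [a0 _] := aI; have [y ay cy] := convergence_radius_gt aR.
rewrite gtr0_norm// in ay.
have [dfa <-] := is_derive_power_sum aR.
set f := power_sum p; set d := 'D_1 f a.
pose D h := h^-1 *: (f (h + a) - f a).
have cD : D h @[h --> 0^'+] --> d.
  apply: cvg_dnbhs_at_right; move: dfa; rewrite /derivable -/(derive f a 1).
  by under eq_fun do rewrite [_%:A]mulr1.
(* The equation with [f'] replaced by its difference quotient. Multiplied by [f a * f (a + h) / h],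
   the lower slope bound becomes [0 <= E h] and the upper one [E h <= k * p 0 * h * D h], which
   tends to [0]. *)
pose E h := (p 0%N + (p 1%N - k * p 0%N) * a) * D h - p 1%N * f a.
have cE : E h @[h --> 0^'+] -->
    (p 0%N + (p 1%N - k * p 0%N) * a) * d - p 1%N * f a.
  apply: cvgB; [exact: cvgMr|exact: cvg_cst].
have cB : k * p 0%N * h * D h @[h --> 0^'+] --> k * p 0%N * 0 * d.
  apply: cvgM => //; apply: cvgMr; exact: cvg_at_right_filter cvg_id.
have EB : \forall h \near 0^'+, 0 <= E h <= k * p 0%N * h * D h.
  near=> h.
  have h0 : 0 < h by near: h; exact: nbhs_right_gt.
  have hy : h < `|y| - a by near: h; apply: nbhs_right_lt; rewrite subr_gt0.
  have bR : (`|h + a|%:E < convergence_radius p)%E.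
    by apply: in_convergence_radius cy _; rewrite gtr0_norm ?addr_gt0//; lra.
  have fa : 0 < f a.
    by apply: power_sum_gt0 => //; [exact: ltW|exact: is_cvg_pseries_radius].
  have fb : 0 < f (h + a).
    by apply: power_sum_gt0 => //; [lra|exact: is_cvg_pseries_radius].
  rewrite gtr0_norm ?addr_gt0// in bR.
  have := slope a (h + a) a0 (ltac:(lra) : a < h + a) bR; rewrite -/f /=.
  move: fa fb; rewrite /E /D /GRing.scale/=.
  move: (f a) (f (h + a)) (p 0%N) (p 1%N) => fa fb q0 q1 fa0 fb0 /andP[l r].
  have S0 : 0 < fa * fb / h by rewrite divr_gt0 ?mulr_gt0.
  have n0 : [/\ h != 0, fa != 0 & fb != 0] by split; rewrite gt_eqF.
  set E1 := (X in 0 <= X <= _); set B1 := (X in _ <= _ <= X).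
  set u := q0 / fa - q0 / fb in l r.
  set v := (q0 + q1 * a) / fa - (q0 + q1 * (h + a)) / fb in l r.
  have E1E : E1 = fa * fb / h * (v - k * a * u).
    by rewrite /E1 /u /v; field; case: n0 => -> -> ->.
  have B1E : B1 - E1 = fa * fb / h * (k * (h + a) * u - v).
    by rewrite /B1 /E1 /u /v; field; case: n0 => -> -> ->.
  by rewrite -[X in _ && X]subr_ge0 B1E E1E !pmulr_rge0// !subr_ge0 l.
rewrite mulr0 mul0r in cB.
apply/eqP; rewrite -subr_eq0 eq_le; apply/andP; split.
- by apply: ler_cvg_to cE cB _; apply: filterS EB => h /andP[].
- by apply: cvgr_to_ge cE _; apply: filterS EB => h /andP[].
Unshelve. all: by end_near. Qed.

End PowerSeriesODE.

(** * The three families *)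

Lemma is_derive_0_ball (R : realType) (h : R -> R) (r x : R) :
  (forall t, `|t| < r -> is_derive t (1 : R) h 0) -> `|x| < r -> h x = h 0.
Proof.
move=> dh xr; have r0 : `|0 : R| < r by rewrite normr0 (le_lt_trans _ xr).
suff main (u v : R) : `|u| < r -> `|v| < r -> u <= v -> h v = h u.
  by have [x0|x0] := leP 0 x; [|apply/esym]; apply: main => //; exact: ltW.
move=> ur vr uv.
have inb (t : R) : t \in `[u, v] -> `|t| < r.
  move: ur vr; rewrite in_itv/= !ltr_norml.
  by move=> /andP[? ?] /andP[? ?] /andP[? ?]; lra.
have [||c _] := @MVT_segment R h (fun=> 0) u v uv.
- by move=> t tuv; apply/dh/inb; exact: subset_itv_oo_cc.
- apply/derivable_within_continuous => t tuv.
  by have [] := dh _ (inb _ tuv).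
- by rewrite mul0r => /eqP; rewrite subr_eq0 => /eqP.
Qed.

Section Families.
Variables (R : realType) (p : R^nat).
Hypotheses (p_ge0 : forall k, 0 <= p k) (p0_gt0 : 0 < p 0%N).

Lemma radius_interval_entire (a : R) :
  (forall x : R, cvgn (pseries p x)) -> 0 < a -> radius_interval p 0 a.
Proof.
move=> cp a0; split=> //; rewrite -(gtr0_norm a0).
by apply: in_convergence_radius (cp (a + 1)) _; rewrite !gtr0_norm//; lra.
Qed.

Lemma poisson_family_rec (l : R) : 0 < l ->
  (forall k, k.+1%:R * p k.+1 = l * p k) -> power_family p = poisson_family R.
Proof.
move=> l0 rec.
have pE k : p k = p 0%N * (l ^+ k / k`!%:R).
  elim: k => [|k ih]; first by rewrite expr0 divr1 mulr1.
  have k0 : k.+1%:R != 0 :> R by rewrite pnatr_eq0.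
  have f0 : k`!%:R != 0 :> R by rewrite pnatr_eq0 -lt0n fact_gt0.
  apply: (mulfI k0); rewrite rec ih factS natrM exprS; field.
  by rewrite f0 addrC natr1 k0.
have cE x : pseries p x @ \oo --> p 0%N * expR (l * x).
  have -> : pseries p x = (fun n => p 0%N * series (exp_coeff (l * x)) n).
    apply/funext => n; rewrite /pseries /series/= mulr_sumr.
    by apply: eq_bigr => i _; rewrite pE /exp_coeff/= exprMn; ring.
  by apply: cvgMr; exact: is_cvg_series_exp_coeff.
have sE x : power_sum p x = p 0%N * expR (l * x) by exact/cvg_lim/cE.
have cp x : cvgn (pseries p x) := cvgP _ (cE x).
(* Here [f x = p 0 * expR (l * x)], so [P_a] is the Poisson law of parameter [l * a]. *)
have ratio a z : power_sum p (a * z) / power_sum p a = expR (l * a * (z - 1)).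
  rewrite !sE -mulf_div divff ?gt_eqF// mul1r -expRN -expRD; congr expR; ring.
apply: power_family_eq => // [a [a0 _]|q q0].
  by exists (l * a) => [|z _]; [rewrite mulr_gt0|exact: ratio].
exists (q / l) => [|z _].
  by apply: radius_interval_entire => //; rewrite divr_gt0.
by rewrite ratio mulrCA divff ?gt_eqF// mulr1.
Qed.

Lemma binomial_family_coef (b : R) (n : nat) : 0 < b ->
  (forall k, p k = p 0%N * ('C(n, k)%:R * b ^+ k)) ->
  power_family p = binomial_family R n.
Proof.
move=> b0 pE.
have cE x : pseries p x @ \oo --> p 0%N * (1 + b * x) ^+ n.
  (* The partial sums are constant beyond index [n], where the binomial coefficients vanish. *)
  apply: cvg_near_cst; near=> m.
  have nm : (n.+1 <= m)%N by near: m; exists n.+1.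
  rewrite /pseries /series/= (big_cat_nat (leq0n _) nm)/=.
  rewrite [X in _ + X]big1_seq ?addr0; last first.
    move=> i /andP[_]; rewrite mem_index_iota => /andP[ni _].
    by rewrite pE bin_small// mul0r mulr0 mul0r.
  rewrite exprDn mulr_sumr big_mkord; apply: eq_bigr => i _.
  by rewrite pE expr1n mul1r exprMn -mulr_natl; ring.
have sE x : power_sum p x = p 0%N * (1 + b * x) ^+ n by exact/cvg_lim/cE.
have cp x : cvgn (pseries p x) := cvgP _ (cE x).
have ratio a z : 0 < a -> let q := b * a / (1 + b * a) in
    power_sum p (a * z) / power_sum p a = (1 - q + q * z) ^+ n.
  move=> a0 q; have d0 : 0 < 1 + b * a by rewrite addr_gt0 ?mulr_gt0.
  rewrite !sE -mulf_div divff ?gt_eqF// mul1r -expr_div_n; congr (_ ^+ n).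
  by rewrite /q; field; rewrite gt_eqF.
apply: power_family_eq => // [a [a0 _]|q /andP[q0 q1]].
  have ba0 : 0 < b * a by rewrite mulr_gt0.
  exists (b * a / (1 + b * a)) => [|z _]; last exact: ratio.
  by apply/andP; split; [rewrite divr_gt0|rewrite ltr_pdivrMr]; lra.
have q1' : 0 < 1 - q by rewrite subr_gt0.
(* The inverse of the change of parameter [q = b a / (1 + b a)]. *)
have a0 : 0 < q / (b * (1 - q)) by rewrite divr_gt0// mulr_gt0.
exists (q / (b * (1 - q))) => [|z _]; first exact: radius_interval_entire.
rewrite ratio//; congr ((_ + _ * z) ^+ n); [congr (1 - _)|]; field.
all: by rewrite !gt_eqF//; lra.
Unshelve. all: by end_near. Qed.

Lemma binomial_coef_rec (b : R) (n : nat) :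
  (forall k, k.+1%:R * p k.+1 = b * (n%:R - k%:R) * p k) ->
  forall k, p k = p 0%N * ('C(n, k)%:R * b ^+ k).
Proof.
move=> rec; elim=> [|k ih]; first by rewrite bin0 expr0 !mulr1.
have k0 : k.+1%:R != 0 :> R by rewrite pnatr_eq0.
apply: (mulfI k0); rewrite rec ih.
have binS : k.+1%:R * 'C(n, k.+1)%:R = (n%:R - k%:R) * 'C(n, k)%:R :> R.
  have [kn|nk] := leqP k n; first by rewrite -natrB// -!natrM mul_bin_left.
  by rewrite !bin_small ?mulr0// ltnW.
transitivity (p 0%N * b ^+ k.+1 * (k.+1%:R * 'C(n, k.+1)%:R)); last ring.
by rewrite binS exprS; ring.
Qed.

(** The recurrence amounts to [(1 - b x) f' = b l f], whose solution is [p 0 / (1 - b x) ^ l]. The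
    radius of convergence is shown to be exactly [b^-1], so that [q = b a] runs over the whole of
    [(0, 1)]. *)
Lemma negative_binomial_family_rec (b l : R) : 0 < b -> 0 < l ->
  (forall k, k.+1%:R * p k.+1 = b * (l + k%:R) * p k) ->
  power_family p = negative_binomial_family R l.
Proof.
move=> b0 l0 rec.
have cp (y : R) : 0 <= y -> b * y < 1 ->
    exists M : R, forall k, `|p k * y ^+ k| <= M.
  move=> y0 by1; have by0 : 0 <= b * y by rewrite mulr_ge0// ltW.
  (* Consecutive terms at [y] have ratio [b y (l + k) / (k + 1)], which is at most [1] from some
     index [K] on. The terms then stop increasing, and the sum of those up to [K] bounds them
     all. *)
  have [K Kb] : exists K : nat, forall k : nat, (K <= k)%N ->
      b * y * (l + k%:R) <= k.+1%:R.
    have [K KE] : exists K : nat, b * y * l / (1 - b * y) <= K%:R.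
      exists (Num.truncn (b * y * l / (1 - b * y))).+1.
      by rewrite ltW// truncnS_gt.
    exists K => k Kk; have : K%:R <= k%:R :> R by rewrite ler_nat.
    move: KE; rewrite ler_pdivrMr; last by lra.
    rewrite -natr1; nra.
  have pos k : 0 <= p k * y ^+ k by rewrite mulr_ge0// exprn_ge0.
  exists (\sum_(i < K.+1) p i * y ^+ i) => k; rewrite ger0_norm//.
  have small i : (i <= K)%N -> p i * y ^+ i <= \sum_(i < K.+1) p i * y ^+ i.
    move=> iK; rewrite (bigD1 (Ordinal (iK : (i < K.+1)%N)))//= lerDl.
    by rewrite sumr_ge0.
  have [/small//|/ltnW /subnKC <-] := leqP k K.
  elim: (k - K)%N => [|j ih]; first by rewrite addn0 small.
  apply: le_trans ih; rewrite addnS.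
  have k0 : 0 < (K + j).+1%:R :> R by rewrite ltr0n.
  rewrite -(ler_pM2l k0) mulrA rec exprS.
  have := ler_wpM2r (pos (K + j)%N) (Kb _ (leq_addr j K)); congr (_ <= _); ring.
have inR (x : R) : b * `|x| < 1 -> (`|x|%:E < convergence_radius p)%E.
  move=> bx.
  (* With [|x| < y < z < b^-1], bounded terms at [z] give convergence at [y], which puts [x]
     strictly inside the radius. *)
  pose y := (2 * `|x| + b^-1) / 3; pose z := (`|x| + 2 * b^-1) / 3.
  have bV : b * b^-1 = 1 by rewrite divff ?gt_eqF.
  have xb : `|x| < b^-1 by rewrite -(ltr_pM2l b0) bV.
  have x0 := normr_ge0 x.
  have z0 : 0 <= z by rewrite /z; lra.
  have y0 : 0 <= y by rewrite /y; lra.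
  have [|M bM] := cp z z0; first by rewrite -bV ltr_pM2l// /z; lra.
  have cy : cvgn (pseries p y).
    by apply: is_cvg_pseries_bounded bM _; rewrite !ger0_norm// /y /z; lra.
  by apply: in_convergence_radius cy _; rewrite (ger0_norm y0) /y; lra.
have ode (x : R) : (`|x|%:E < convergence_radius p)%E ->
    (1 - b * x) * power_sum (pseries_diffs p) x = b * l * power_sum p x.
  move=> xR; rewrite -mulNr; apply: coef_ode => // k.
  by rewrite mul1r rec; ring.
(* The equation forces the power sum, which is positive, to vanish at b^-1 if
   b^-1 lies inside the disk of convergence. *)
have Rin (x : R) : (`|x|%:E < convergence_radius p)%E -> b * `|x| < 1.
  move=> xR; rewrite ltNge; apply/negP => bx.
  have bR : (`|b^-1|%:E < convergence_radius p)%E.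
    apply: le_lt_trans xR; rewrite lee_fin gtr0_norm ?invr_gt0//.
    by rewrite -(ler_pM2l b0) divff// gt_eqF.
  have := ode _ bR; rewrite divff ?gt_eqF// subrr mul0r => /esym/eqP.
  rewrite gt_eqF// !mulr_gt0//; apply: power_sum_gt0 => //.
    by rewrite invr_ge0 ltW.
  exact: is_cvg_pseries_radius.
have pos1 (x : R) : b * `|x| < 1 -> 0 < 1 - b * x.
  move=> bx; rewrite subr_gt0 (le_lt_trans _ bx)// ler_wpM2l ?ler_norm// ltW//.
have sE (x : R) : b * `|x| < 1 -> power_sum p x = p 0%N / (1 - b * x) `^ l.
  (* By the differential equation [h] has zero derivative on the disk of radius [b^-1], so it keeps
     its value [p 0]. *)
  move=> bx; pose h (t : R) := power_sum p t * (1 - b * t) `^ l.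
  suff hE : h x = h 0.
    move: hE; rewrite /h power_sum0 mulr0 subr0 powR1 mulr1 => <-.
    by rewrite mulfK// gt_eqF// powR_gt0// pos1.
  apply: (@is_derive_0_ball _ _ b^-1); last first.
    by rewrite -(ltr_pM2l b0) divff ?gt_eqF.
  move=> t; rewrite -(ltr_pM2l b0) divff ?gt_eqF// => bt.
  have t0 := pos1 t bt; have dp := is_derive_power_sum (inR t bt).
  have dl : is_derive t (1 : R) (fun t => 1 - b * t) (- b).
    apply: is_derive_eq.
    by rewrite add0r mul1r [_%:A]mulr1.
  have dc := @is_derive1_comp R (fun x => x `^ l) (fun t => 1 - b * t) t _ _
    (is_derive1_powR l t0) dl.
  have dh : is_derive t 1 h _ := is_deriveM dp dc.
  apply: (is_derive_eq dh).
  (* Writing the power as [(1 - b t)] times its [l - 1] power exposes a common factor, and the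
     cofactor is the differential equation. *)
  rewrite /= /GRing.scale/= -(mulr_powRB1 (ltW t0) l0).
  have := ode t (inR t bt); set g := _ `^ (l - 1).
  set f := power_sum p t; set f' := power_sum _ t => odet.
  transitivity (g * ((1 - b * t) * f' - b * l * f)); first ring.
  by rewrite odet subrr mulr0.
have ratio (a z : R) : b * `|a| < 1 -> `|z| <= 1 ->
    power_sum p (a * z) / power_sum p a =
    (1 - b * a) `^ l / (1 - b * a * z) `^ l.
  move=> ba z1; have baz : b * `|a * z| < 1.
    by rewrite (le_lt_trans _ ba)// ler_wpM2l ?(ltW b0)// normrM ler_piMr.
  have e1 : (1 - b * a) `^ l != 0 by rewrite gt_eqF// powR_gt0// pos1.
  have e2 : (1 - b * a * z) `^ l != 0.
    by rewrite gt_eqF// powR_gt0// -mulrA pos1.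
  rewrite !sE// mulrA; field.
  by rewrite e1 e2 gt_eqF.
apply: power_family_eq => // [a aI|q /andP[q0 q1]].
  have [a0 _] := aI; have ba := Rin a (radius_interval_norm aI).
  exists (b * a) => [|z z1]; last exact: ratio.
  by rewrite mulr_gt0//= -(gtr0_norm a0).
have bq : b * (q / b) = q by rewrite mulrCA divff ?gt_eqF// mulr1.
have qb0 : 0 < q / b by rewrite divr_gt0.
have bqn : b * `|q / b| < 1 by rewrite gtr0_norm// bq.
exists (q / b) => [|z z1]; last by rewrite ratio// bq.
by split=> //; rewrite -(gtr0_norm qb0); exact: inR.
Qed.

End Families.

(** * From the coefficient recurrence to the three families *)

Lemma family_of_rec (R : realType) (p : R^nat) (B : R) :
  (forall k, 0 <= p k) -> 0 < p 0%N -> (exists k, 0 < p k.+1) ->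
  (forall k, p 0%N * (k.+1%:R * p k.+1) = (p 1%N - B * k%:R) * p k) ->
  (exists2 n : nat, (1 <= n)%N & power_family p = binomial_family R n)
  \/ power_family p = poisson_family R
  \/ (exists2 l : R, 0 < l & power_family p = negative_binomial_family R l).
Proof.
move=> p_ge0 p0_gt0 [m pm] rec; have p0_neq0 : p 0%N != 0 by rewrite gt_eqF.
have recV k : k.+1%:R * p k.+1 = (p 1%N - B * k%:R) / p 0%N * p k.
  by apply: (mulfI p0_neq0); rewrite rec; field.
have k0 k : k.+1%:R != 0 :> R by rewrite pnatr_eq0.
(* If [p 1] were zero, the recurrence would carry this zero to every later coefficient. *)
have p1_gt0 : 0 < p 1%N.
  rewrite lt_neqAle p_ge0 andbT eq_sym; apply/negP => /eqP p10.
  suff p0S k : p k.+1 = 0 by move: pm; rewrite p0S ltxx.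
  elim: k => // k ih; apply/eqP; rewrite -(mulrI_eq0 _ (mulfI (k0 k.+1))).
  by rewrite recV ih mulr0.
have [B0|B0|B0] := ltrgtP B 0.
- right; right; exists (p 1%N / - B); first by rewrite divr_gt0// oppr_gt0.
  apply: (@negative_binomial_family_rec _ _ _ _ (- B / p 0%N)) => //.
  + by rewrite divr_gt0// oppr_gt0.
  + by rewrite divr_gt0// oppr_gt0.
  + move=> k; rewrite recV; congr (_ * _); field.
    by rewrite p0_neq0 lt_eqF.
(* Otherwise no factor [p 1 - B k] vanishes and every coefficient is positive; but for [k > p 1 / B]
   the factor is negative, a contradiction. *)
- left; have [n pn] : exists n : nat, p 1%N = B * n%:R.
    apply: contrapT => /forallNP nB.
    have pos k : 0 < p k.
      elim: k => // k ih; rewrite lt_neqAle p_ge0 andbT eq_sym.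
      rewrite -(mulrI_eq0 _ (mulfI (k0 k))) recV mulf_neq0 ?(gt_eqF ih)//.
      by rewrite mulf_neq0 ?invr_eq0// subr_eq0; apply/eqP/nB.
    have [k pk] : exists k : nat, p 1%N / B < k%:R.
      by exists (Num.truncn (p 1%N / B)).+1; exact: truncnS_gt.
    have := mulr_gt0 (ltr0Sn R k) (pos k.+1).
    rewrite recV pmulr_lgt0// pmulr_lgt0 ?invr_gt0// subr_gt0 ltNge.
    by rewrite -ler_pdivrMl// mulrC ltW.
  exists n.
    by rewrite lt0n; apply: contraTneq p1_gt0 => n0; rewrite pn n0 mulr0 ltxx.
  apply: (@binomial_family_coef _ _ _ _ (B / p 0%N)) => //.
    by rewrite divr_gt0.
  apply: binomial_coef_rec => k; rewrite recV pn; congr (_ * _).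
  by field.
- right; left; apply: (@poisson_family_rec _ _ _ _ (p 1%N / p 0%N)) => //.
    by rewrite divr_gt0.
  by move=> k; rewrite recV B0 mul0r subr0.
Qed.

Theorem theorem1 (R : realType) (p : R^nat)
  (p_ge0 : forall k : nat, 0 <= p k)
  (radius_gt0 : (0 < convergence_radius p)%E)
  (p0_gt0 : 0 < p 0%N)
  (f_not_constant : ~ exists C : R, forall x : R,
     (`|x|%:E < convergence_radius p)%E -> power_sum p x = C)
  (mu : {measure set (measurableTypeR R) -> \bar R})
  (mu_domain : mu (~` radius_interval p 0) = 0%E)
  (c : R^nat)
  (cdf_integral : forall k : nat, (k%:R%:E < support_sup p)%E ->
     forall a : R, radius_interval p 0 a ->
     forall P : probability nat R, is_power_law p a P ->
     P [set j : nat | (j <= k)%N] =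
       ((c k)%:E * \int[mu]_(u in radius_interval p a) (u ^+ k)%:E)%E) :
  (exists2 n : nat, (1 <= n)%N & power_family p = binomial_family R n)
  \/ power_family p = poisson_family R
  \/ (exists2 l : R, 0 < l & power_family p = negative_binomial_family R l).
Proof.
have vanish (q : nat -> nat) : ~ (exists k, 0 < p (q k)) ->
    forall k, p (q k) = 0.
  move=> /forallNP q0 k; apply/eqP.
  by rewrite eq_le p_ge0 andbT leNgt; apply/negP.
have [m pm] : exists m, 0 < p m.+1.
  apply: contrapT => /vanish pS; apply: f_not_constant; exists (p 0%N) => x _.
  exact: power_sum_cst.
have sup_lt (k j : nat) : (k < j)%N -> 0 < p j -> (k%:R%:E < support_sup p)%E.
  move=> kj pj; apply: (@lt_le_trans _ _ (j%:R%:E)).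
    by rewrite lte_fin ltr_nat.
  by apply: ereal_sup_ubound; exists j.
(* If all coefficients from index [2] on vanish, then [f x = p 0 * (1 + b x)] with [b = p 1 / p 0],
   the binomial case with [n = 1]. Otherwise [0] and [1] are both below the supremum of the
   support. *)
have [[n pn]|/vanish p2] := pselect (exists n, 0 < p n.+2); last first.
  left; exists 1%N => //.
  have p1_gt0 : 0 < p 1%N by case: m pm => // m; rewrite p2 ltxx.
  apply: (@binomial_family_coef _ _ _ _ (p 1%N / p 0%N)) => //.
    by rewrite divr_gt0.
  case=> [|[|k]]; first by rewrite bin0 expr0 !mulr1.
    by rewrite bin1 expr1 mul1r mulrCA divff ?mulr1// gt_eqF.
  by rewrite p2 bin_small// mul0r mulr0.
have sup1 (k : nat) : (k <= 1)%N -> (k%:R%:E < support_sup p)%E.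
  by move=> k1; apply: sup_lt pn; rewrite (leq_ltn_trans k1).
have f_gt0 x : radius_interval p 0 x -> 0 < power_sum p x.
  move=> xI; apply: power_sum_gt0 => //; first by apply: ltW; case: xI.
  exact: cvg_pseries_in.
have cdf (k : nat) x : (k <= 1)%N -> radius_interval p 0 x ->
    ((c k)%:E * \int[mu]_(u in radius_interval p x) (u ^+ k)%:E =
     ((\sum_(i < k.+1) p i * x ^+ i) / power_sum p x)%:E)%E.
  (* The hypothesis speaks of laws, so one has to be exhibited before it yields an identity on
     [f]. *)
  move=> k1 xI; have [P xP] := power_law_exists p_ge0 p0_gt0 xI.
  by rewrite -(cdf_integral k (sup1 k k1) x xI P xP) (power_law_cdf _ xP).
have slope (a b : R) : 0 < a -> a < b -> (b%:E < convergence_radius p)%E ->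
    let F0 x := p 0%N / power_sum p x in
    let F1 x := (p 0%N + p 1%N * x) / power_sum p x in
    c 1%N / c 0%N * a * (F0 a - F0 b) <= F1 a - F1 b
      <= c 1%N / c 0%N * b * (F0 a - F0 b).
  move=> a0 ab bR /=; apply: (@moment_slope _ p mu _ _
    (fun x => p 0%N / power_sum p x)
    (fun x => (p 0%N + p 1%N * x) / power_sum p x)) => // x xI.
  - have x0 : 0 < x by case: xI.
    by split; rewrite divr_gt0 ?f_gt0// ltr_wpDr// mulr_ge0// ltW.
  - by rewrite cdf// big_ord1 expr0 mulr1.
  - by rewrite cdf// !big_ord_recl big_ord0 /= addr0 expr0 mulr1.
apply: (@family_of_rec _ _ (p 1%N - c 1%N / c 0%N * p 0%N)) => //.
  by exists m.
by apply: ode_coef => // x xI; exact: slope_ode slope xI.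
Qed.
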